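(* Let $\gamma,\beta:\mathbb{R}_+\to[0,\infty)$ be continuous functions. Let $\alpha:\mathbb{R}_+\times\mathbb{R}_+\to[0,\infty)$ be continuous, nondecreasing with respect to its second argument (i.e. $\alpha(t,g)\ge\alpha(t,h)$ if $g\ge h$), and locally Lipschitz with respect to its second argument, in the sense that for all $T<\infty$ and $M>0$ there is a constant $L(T,M)>0$, independent of $g$, $h$ and $t$, such that $$|\alpha(t,g)-\alpha(t,h)|\le L(T,M)|g-h|\quad\text{if } t\in[0,T],\ |g|\le M,\ |h|\le M.$$ Let $g(t)\ge 0$ be a function defined on some interval $[0,T)$ which has a bounded right derivative $\dot g(t)$ at every point of this interval and satisfies $$\dot g(t)\le-\gamma(t)g(t)+\alpha(t,g(t))+\beta(t),\qquad g(0)=g_0,$$ at all $t$ at which $g(t)$ is defined. Assume that there exists a function $\mu\in C^1(\mathbb{R}_+)$, $\mu(t)>0$, such that $$\alpha\left(t,\frac1{\mu(t)}\right)+\beta(t)\le\frac1{\mu(t)}\left(\gamma(t)-\frac{\dot\mu(t)}{\mu(t)}\right)\quad\forall t\ge0,\qquad \mu(0)g(0)<1.$$ Then any such solution $g(t)\ge0$ of the differential inequality exists on all of $\mathbb{R}_+$, i.e. $T=\infty$, and satisfies $$0\le g(t)<\frac1{\mu(t)}\qquad\forall t\in\mathbb{R}_+.$$ If the condition $\mu(0)g(0)<1$ is replaced by $\mu(0)g(0)\le1$, then $0\le g(t)\le\frac1{\mu(t)}$ for all $t\in\mathbb{R}_+$.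
   Context: $\mathbb{R}_+:=[0,\infty)$. For the function $g$, the derivative is the right derivative $\dot g(t):=\lim_{s\to+0}\frac{g(t+s)-g(t)}{s}$. It is not assumed a priori that solutions $g$ of the differential inequality are defined on all of $\mathbb{R}_+$ (that is, that they exist globally); $[0,T)$ denotes the interval on which $g$ exists. $\dot\mu$ is the derivative of $\mu$.
   Formalization: The solution g is additionally assumed continuous on [0,T); with only a right derivative at every point the claim fails (γ=α=β=0, μ=1, g=0 on [0,1), g=2 on [1,∞)). ''T=∞'' is asserted for solutions that cannot be extended to a larger interval. *)

(* Defs.v *)
From mathcomp Require Import all_boot all_order all_algebra.
From mathcomp Require Import all_classical all_reals all_analysis.
Import Order.TTheory GRing.Theory Num.Theory.
Import numFieldNormedType.Exports.

Set Implicit Arguments.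
Unset Strict Implicit.
Unset Printing Implicit Defensive.

Local Open Scope classical_set_scope.
Local Open Scope ring_scope.

(* Functions on R_+ (or on [0, T)) are represented by total functions on R
   whose values outside the domain are never constrained: continuity is taken
   in the subspace topology, and differentiability within the domain. *)

Definition Rplus (R : realType) : set R := [set t | 0 <= t].

(* T = +oo is allowed. *)
Definition upto (R : realType) (T : \bar R) : set R :=
  [set t | 0 <= t /\ (t%:E < T)%E].

Definition right_derivative (R : realType) (g : R -> R) (t l : R) : Prop :=
  (g (t + s) - g t) / s @[s --> 0^'+] --> l.

(* f is C^1 on R_+ with derivative df; the derivative at 0 is one-sided
   because only points s of R_+ are taken into account. *)
Definition C1_Rplus (R : realType) (f df : R -> R) : Prop :=
  (forall t, 0 <= t ->
     (f s - f t) / (s - t) @[s --> within (@Rplus R) t^'] --> df t) /\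
  {within @Rplus R, continuous df}.

Definition locally_lipschitz2 (R : realType) (alpha : R -> R -> R) : Prop :=
  forall T M : R, 0 < M -> exists2 L : R, 0 < L &
    forall t g h, 0 <= t <= T -> 0 <= g -> 0 <= h -> `|g| <= M -> `|h| <= M ->
      `|alpha t g - alpha t h| <= L * `|g - h|.

(* g is a nonnegative solution on [0, T) of the differential inequality
   g' <= - gamma g + alpha(t, g) + beta, where g' is the right derivative.
   Continuity has to be required: a right derivative at every point does not
   exclude upward jumps from the left, and with gamma = alpha = beta = 0,
   mu = 1 and g the indicator of [1, +oo[ multiplied by 2, every other clause
   holds while g exceeds 1 / mu. *)
Definition solution (R : realType) (gamma : R -> R) (alpha : R -> R -> R)
    (beta : R -> R) (T : \bar R) (g : R -> R) : Prop :=
  [/\ (0 < T)%E,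
      forall t, upto T t -> 0 <= g t,
      {within upto T, continuous g} &
      forall t, upto T t -> exists2 dg, right_derivative g t dg &
        dg <= - gamma t * g t + alpha t (g t) + beta t].

(* [0, T) is the whole interval of existence of the solution g: no solution on
   a strictly larger interval extends g. *)
Definition maximal_solution (R : realType) (gamma : R -> R)
    (alpha : R -> R -> R) (beta : R -> R) (T : \bar R) (g : R -> R) : Prop :=
  solution gamma alpha beta T g /\
  forall (T' : \bar R) (h : R -> R), (T <= T')%E ->
    solution gamma alpha beta T' h -> (forall t, upto T t -> h t = g t) ->
    T' = T.

(* Main.v *)
Require Import Defs.
From mathcomp Require Import all_boot all_order all_algebra.
From mathcomp Require Import all_classical all_reals all_analysis.
From mathcomp Require Import ring lra.
Import Order.TTheory GRing.Theory Num.Theory.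
Import numFieldNormedType.Exports.

Set Implicit Arguments.
Unset Strict Implicit.
Unset Printing Implicit Defensive.

Local Open Scope classical_set_scope.
Local Open Scope ring_scope.

(** Put [y = mu * g - 1]; the claim is [y <= 0], or [y < 0] when [y 0 < 0].
    Write [c = gamma - dmu / mu] for the rate on the right of the inequality
    for [mu]. The product rule and the two differential inequalities give
      [y' <= - c * y + mu * (alpha (t, g) - alpha (t, 1 / mu))]
    ([supersolution_excess]), and [c >= 0] because [alpha] and [beta] are
    nonnegative. Where [y >= 0], the Lipschitz condition bounds the last term
    by [L * y], so [y' <= L * y]: started from its last zero, [y] cannot become
    positive ([supersolution_bound]). Once [y <= 0] is known, monotonicity of
    [alpha] makes the last term nonpositive, and [y' <= - K * y] for an upper
    bound [K] of [c], so that [y t <= y 0 * exp (- K * t) < 0] when [y 0 < 0]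
    ([supersolution_strict_bound]). Both steps use Gronwall's inequality for
    right derivatives, which rests on the fact that a continuous function with
    nonpositive right derivative is nonincreasing.

    For global existence, suppose [T] is finite. On [0, T) the right
    derivative of [g] is at most [1 / mu * c], hence bounded above by some [C],
    so [g - C * t] is nonincreasing and bounded below and [g] has a left limit
    [l >= 0] at [T] ([right_derivative_le_left_limit]). What has to be extended
    is a solution of a differential inequality, so no initial value problem
    needs to be solved: on [T, T + 1) the function [l * exp (- K * (t - T))],
    with [K] an upper bound of [gamma] there, has derivative at most
    [- gamma] times itself ([solution_extension]). This contradicts the
    maximality of [T]. *)

(** * Right derivatives *)

Lemma right_derivative_right_continuous (R : realType) (f : R -> R) (t l : R) :
  right_derivative f t l -> f (t + s) @[s --> 0^'+] --> f t.
Proof.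
move=> fl.
have id0 : s @[s --> 0^'+] --> (0 : R).
  by apply: cvg_at_right_filter; exact: cvg_id.
have : f t + (f (t + s) - f t) / s * s @[s --> 0^'+] --> f t + l * 0.
  by apply: cvgD; [exact: cvg_cst | exact: cvgM fl id0].
rewrite mulr0 addr0; apply: cvg_trans; apply: near_eq_cvg.
near=> s.
have s0 : 0 < s by near: s; exact: nbhs_right_gt.
by rewrite divfK ?gt_eqF// subrKC.
Unshelve. all: by end_near. Qed.

Lemma right_derivativeM (R : realType) (f g : R -> R) (t a b : R) :
  right_derivative f t a -> right_derivative g t b ->
  right_derivative (fun s => f s * g s) t (a * g t + f t * b).
Proof.
move=> fa gb; have gt := right_derivative_right_continuous gb.
have : (f (t + s) - f t) / s * g (t + s) + f t * ((g (t + s) - g t) / s)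
    @[s --> 0^'+] --> a * g t + f t * b.
  apply: cvgD; apply: cvgM; [exact: fa|exact: gt|exact: cvg_cst|exact: gb].
by apply: cvg_trans; apply: near_eq_cvg; near=> s; ring.
Unshelve. all: by end_near. Qed.

Lemma right_derivativeB (R : realType) (f g : R -> R) (t a b : R) :
  right_derivative f t a -> right_derivative g t b ->
  right_derivative (fun s => f s - g s) t (a - b).
Proof.
move=> fa gb.
have : (f (t + s) - f t) / s - (g (t + s) - g t) / s @[s --> 0^'+] --> a - b.
  by apply: cvgB; [exact: fa | exact: gb].
by apply: cvg_trans; apply: near_eq_cvg; near=> s; ring.
Unshelve. all: by end_near. Qed.

Lemma right_derivative_is_derive (R : realType) (f : R -> R) (t l : R) :
  is_derive t 1 f l -> right_derivative f t l.
Proof.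
move=> [/cvg_dnbhs_at_right dl]; rewrite /derive => dE.
rewrite dE in dl; apply: cvg_trans dl; apply: near_eq_cvg; near=> s.
by rewrite /= [_%:A]mulr1 [s + t]addrC mulrC.
Unshelve. all: by end_near. Qed.


Lemma near_eq_right_derivative (R : realType) (f h : R -> R) (t l : R) :
  (\forall s \near 0^'+, f (t + s) = h (t + s)) -> f t = h t ->
  right_derivative f t l -> right_derivative h t l.
Proof.
move=> fh fht; apply: cvg_trans; apply: near_eq_cvg.
by apply: filterS fh => s ->; rewrite fht.
Qed.

(** * Functions of class C1 on the half-line *)

Lemma C1_right_derivative (R : realType) (f df : R -> R) (t : R) :
  C1_Rplus f df -> 0 <= t -> right_derivative f t (df t).
Proof.
move=> [fdf _] t0.
have tc : t + s @[s --> 0^'+] --> t.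
  rewrite -[X in _ --> X]addr0; apply: cvgD; first exact: cvg_cst.
  by apply: cvg_at_right_filter; exact: cvg_id.
have tw : t + s @[s --> 0^'+] --> within (@Rplus R) t^'.
  move=> A /tc; apply: filterS2 (nbhs_right_gt 0) => s s0; apply.
    by rewrite gt_eqF// ltrDl.
  by rewrite /Rplus /= addr_ge0// ltW.
have := cvg_comp _ _ tw (fdf t t0).
apply: cvg_trans; apply: near_eq_cvg; near=> s.
by rewrite /= [t + s - t]addrAC subrr add0r.
Unshelve. all: by end_near. Qed.

Lemma C1_continuous (R : realType) (f df : R -> R) :
  C1_Rplus f df -> {within @Rplus R, continuous f}.
Proof.
move=> [fdf _]; apply/subspace_continuousP => t t0.
have punctured : f s @[s --> within (@Rplus R) t^'] --> f t.
  have : f t + (f s - f t) / (s - t) * (s - t)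
      @[s --> within (@Rplus R) t^'] --> f t + df t * (t - t).
    apply: cvgD; first exact: cvg_cst.
    apply: cvgM; first exact: fdf.
    apply: cvgB; last exact: cvg_cst.
    by apply: cvg_within_filter; apply: cvg_within_filter; exact: cvg_id.
  rewrite subrr mulr0 addr0; apply: cvg_trans; apply: near_eq_cvg.
  apply: (@nearW _ (nbhs t)) => s st _.
  by rewrite divfK ?subr_eq0// subrKC.
move=> V Vft; apply: (@filterS _ (nbhs t)) (punctured V Vft) => s sV s0.
have [->|st] := eqVneq s t; first exact: nbhs_singleton Vft.
exact: sV.
Qed.

Lemma C1_inv_continuous (R : realType) (mu dmu : R -> R) :
  C1_Rplus mu dmu -> (forall t, 0 <= t -> 0 < mu t) ->
  {within @Rplus R, continuous (fun t => (mu t)^-1)}.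
Proof.
move=> muC mu0; apply/subspace_continuousP => t t0.
apply: cvgV; first by rewrite gt_eqF// mu0.
exact: (subspace_continuousP _ _).1 (C1_continuous muC) _ t0.
Qed.

Lemma C1_rate_continuous (R : realType) (gamma mu dmu : R -> R) :
  {within @Rplus R, continuous gamma} ->
  C1_Rplus mu dmu -> (forall t, 0 <= t -> 0 < mu t) ->
  {within @Rplus R, continuous (fun t => gamma t - dmu t / mu t)}.
Proof.
move=> gammac muC mu0 t; apply: cvgB; first exact: gammac.
by apply: cvgM; [exact: muC.2|exact: C1_inv_continuous muC mu0 t].
Qed.

(** * Monotonicity and Gronwall's inequality for right derivatives *)

(** The last point where a continuous function takes a level that it exceeds at
    the right end: from there on only right derivatives are needed to control
    the excess. *)
Lemma last_level_point (R : realType) (u : R -> R) (a b k : R) :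
  {within `[a, b], continuous u} -> a <= b -> u a <= k -> k < u b ->
  exists c, [/\ a <= c < b, u c = k & forall t, c < t <= b -> k < u t].
Proof.
move=> uc ab uak kub.
pose S := [set t | a <= t <= b /\ u t <= k].
have Sa : S a by rewrite /S /= lexx ab; split.
have ubS : ubound S b by move=> t [/andP[_ tb] _].
have supS : has_sup S by split; [exists a|exists b].
have ac : a <= sup S by exact: sup_upper_bound.
have cb : sup S <= b by apply: ge_sup ubS; exists a.
have uck : u (sup S) <= k.
  rewrite leNgt; apply/negP => kuc.
  have cab : `[a, b]%classic (sup S) by rewrite /= in_itv/= ac cb.
  have := (subspace_continuousP _ _).1 uc _ cab.
  move=> /cvgr_gt/(_ _ kuc) near_c.
  have [t [[tab utk]]] := closure_sup supS.1 supS.2 near_c.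
  by rewrite /= in_itv/= => /(_ tab); rewrite ltNge utk.
have sup_S t : a <= t -> t <= b -> u t <= k -> t <= sup S.
  by move=> at_ tb utk; apply: sup_upper_bound => //; split; [exact/andP|].
exists (sup S); split.
- rewrite ac /= lt_neqAle cb andbT; apply: contraTneq kub => <-.
  by rewrite -leNgt.
- have sub : `[sup S, b] `<=` `[a, b].
    by move=> s /=; rewrite !in_itv/= => /andP[/(le_trans ac)-> ->].
  have [|d] := @IVT _ u _ _ k cb (continuous_subspaceW sub uc).
    by rewrite ge_min uck le_max (ltW kub) orbT.
  rewrite in_itv/= => /andP[cd db] udk.
  suff <- : d = sup S by [].
  by apply/eqP; rewrite eq_le cd sup_S// ?udk// (le_trans ac).
- move=> t /andP[ct tb]; rewrite ltNge; apply: contraTN ct => utk.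
  have [at_|/ltW ta] := leP a t; first by rewrite -leNgt sup_S.
  by rewrite -leNgt (le_trans ta).
Qed.

(** If [u a < u b], subtract a line whose slope [eps] is half the mean slope of
    [u]. The difference [v] still ends above [v a], so at the last point where
    it equals [v a] its right derivative is nonnegative; but that derivative is
    at most [- eps]. *)
Lemma right_derivative_le0_nonincreasing (R : realType) (u : R -> R) (a b : R) :
  a <= b -> {within `[a, b], continuous u} ->
  (forall t, a <= t < b -> exists2 l, right_derivative u t l & l <= 0) ->
  u b <= u a.
Proof.
move=> ab uc du; rewrite leNgt; apply/negP => uab.
have {}ab : a < b.
  by rewrite lt_neqAle ab andbT; apply: contraTneq uab => ->; rewrite ltxx.
pose eps := (u b - u a) / (b - a) / 2.
have eps0 : 0 < eps by rewrite !divr_gt0 ?subr_gt0.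
pose v t := u t - eps * t.
have vc : {within `[a, b], continuous v}.
  move=> x; apply: cvgB; first exact: uc.
  apply: cvgM; first exact: cvg_cst.
  by apply: continuous_subspaceT => y; exact: cvg_id.
have vab : v a < v b.
  suff : eps * (b - a) < u b - u a by rewrite /v mulrBr; lra.
  have -> : eps * (b - a) = (u b - u a) / 2.
    by rewrite /eps; field; rewrite subr_eq0 gt_eqF.
  by rewrite -subr_gt0 in uab; lra.
have [c [/andP[ac cb] vca vgt]] := last_level_point vc (ltW ab) (lexx _) vab.
have [|l dl l0] := du c; first by rewrite ac.
have id_rd : right_derivative (fun s => eps * s) c eps.
  apply: right_derivative_is_derive.
  by apply: is_derive_eq; rewrite /GRing.scale /= !mulr1.
have dv : right_derivative v c (l - eps) by exact: right_derivativeB.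
suff : 0 <= l - eps by lra.
apply: (cvgr_to_ge dv); near=> s.
have s0 : 0 < s by near: s; exact: nbhs_right_gt.
rewrite divr_ge0 ?(ltW s0)// subr_ge0 vca ltW// vgt//.
rewrite ltrDl s0 /= -lerBrDl; near: s; apply: nbhs_right_le.
by rewrite subr_gt0.
Unshelve. all: by end_near. Qed.

Lemma right_derivative_expR (R : realType) (K t : R) :
  right_derivative (fun s => expR (K * s)) t (K * expR (K * t)).
Proof.
apply: right_derivative_is_derive.
by apply: is_derive_eq; rewrite /GRing.scale /=; ring.
Qed.

(** The function [u t * exp (- K * t)] has nonpositive right derivative. The
    constant [K] may have either sign. *)
Lemma right_derivative_gronwall (R : realType) (u : R -> R) (K a b : R) :
  a <= b -> {within `[a, b], continuous u} ->
  (forall t, a <= t < b -> exists2 l, right_derivative u t l & l <= K * u t) ->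
  u b <= u a * expR (K * (b - a)).
Proof.
move=> ab uc du.
have : u b * expR (- K * b) <= u a * expR (- K * a).
  apply: (@right_derivative_le0_nonincreasing _
    (fun t => u t * expR (- K * t))) => //.
    move=> x; apply: cvgM; first exact: uc.
    apply: continuous_subspaceT => y; apply: continuous_comp.
      by apply: cvgM; [exact: cvg_cst|exact: cvg_id].
    exact: continuous_expR.
  move=> t /du[l dl lK].
  have dv := right_derivativeM dl (@right_derivative_expR R (- K) t).
  eexists; first exact: dv.
  have -> : l * expR (- K * t) + u t * (- K * expR (- K * t)) =
            (l - K * u t) * expR (- K * t) by ring.
  by rewrite pmulr_lle0 ?expR_gt0// subr_le0.
rewrite -(ler_pM2r (expR_gt0 (K * b))) -!mulrA -!expRD.
by rewrite -mulrDl addNr mul0r expR0 mulr1 mulrBr mulNr addrC.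
Qed.

(** * Comparison with the supersolution 1 / mu *)

Lemma segment_upto (R : realType) (T : \bar R) (t : R) :
  upto T t -> `[0, t] `<=` upto T.
Proof.
move=> [t0 tT] s /=; rewrite in_itv/= => /andP[s0 st]; split => //.
by apply: le_lt_trans tT; rewrite lee_fin.
Qed.

Lemma segment_Rplus (R : realType) (t : R) : `[0, t] `<=` @Rplus R.
Proof. by move=> s /=; rewrite in_itv/= => /andP[]. Qed.

Lemma supersolution_rate_ge0 (R : realType) (gamma beta mu dmu : R -> R)
    (alpha : R -> R -> R) (t : R) :
  0 <= alpha t (1 / mu t) -> 0 <= beta t -> 0 < mu t ->
  alpha t (1 / mu t) + beta t <= 1 / mu t * (gamma t - dmu t / mu t) ->
  0 <= gamma t - dmu t / mu t.
Proof.
move=> a0 b0 mu0 /(le_trans (addr_ge0 a0 b0)).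
by rewrite pmulr_rge0// divr_gt0.
Qed.

(** Working with [mu * g - 1] instead of [g - 1 / mu] turns the comparison into
    a product rule, and makes the rate [gamma - dmu / mu] of the hypothesis on
    [mu] appear as the damping coefficient. *)
Lemma supersolution_excess (R : realType) (gamma beta mu dmu g : R -> R)
    (alpha : R -> R -> R) (t dg : R) :
  0 < mu t -> right_derivative mu t (dmu t) -> right_derivative g t dg ->
  dg <= - gamma t * g t + alpha t (g t) + beta t ->
  alpha t (1 / mu t) + beta t <= 1 / mu t * (gamma t - dmu t / mu t) ->
  exists2 l, right_derivative (fun s => mu s * g s - 1) t l &
    l <= - (gamma t - dmu t / mu t) * (mu t * g t - 1) +
         mu t * (alpha t (g t) - alpha t (1 / mu t)).
Proof.
move=> mu0 dmut dgt dg_le mu_le.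
have cst_rd : right_derivative (fun=> 1) t (0 : R).
  by apply: right_derivative_is_derive; exact: is_derive_cst.
have dy := right_derivativeB (right_derivativeM dmut dgt) cst_rd.
eexists; first exact: dy.
have : mu t * dg <= mu t * (- gamma t * g t + alpha t (g t) + beta t).
  by rewrite ler_pM2l.
have : mu t * (alpha t (1 / mu t) + beta t) <= gamma t - dmu t / mu t.
  rewrite -(ler_pM2l mu0) in mu_le.
  by rewrite [X in _ <= X]mulrA div1r divff ?gt_eqF// mul1r in mu_le *.
have : dmu t / mu t * (mu t * g t) = dmu t * g t.
  by rewrite mulrA divfK// gt_eqF.
lra.
Qed.

(** On the interval that follows the last zero of [y = mu * g - 1] the damping
    term can be dropped, since [y >= 0] there, and the Lipschitz condition gives
    [y' <= L * y]. Hence [y] stays at [0], whereas it was assumed positive at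
    the right end. *)
Lemma supersolution_bound (R : realType) (gamma beta : R -> R)
    (alpha : R -> R -> R) (T : \bar R) (g mu dmu : R -> R) :
  (forall t, 0 <= t -> 0 <= beta t) ->
  (forall t g, 0 <= t -> 0 <= g -> 0 <= alpha t g) ->
  locally_lipschitz2 alpha ->
  solution gamma alpha beta T g -> C1_Rplus mu dmu ->
  (forall t, 0 <= t -> 0 < mu t) ->
  (forall t, 0 <= t ->
     alpha t (1 / mu t) + beta t <= 1 / mu t * (gamma t - dmu t / mu t)) ->
  mu 0 * g 0 <= 1 -> forall t, upto T t -> mu t * g t <= 1.
Proof.
move=> beta0 alpha0 alpha_lip [_ g0 gc dg] muC mu0 mu_ineq init t tT.
have t0 : 0 <= t by case: tT.
have sub := segment_upto tT.
have gct := continuous_subspaceW sub gc.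
have muct := continuous_subspaceW (@segment_Rplus R t) (C1_continuous muC).
have in0t (s : R) : s \in `[0, t] -> 0 <= s by rewrite in_itv/= => /andP[].
have imuct : {within `[0, t], continuous (fun s => 1 / mu s)}.
  move=> s; apply: cvgM; first exact: cvg_cst.
  exact: continuous_subspaceW (@segment_Rplus R t)
    (C1_inv_continuous muC mu0) s.
pose y s := mu s * g s - 1.
have yc : {within `[0, t], continuous y}.
  move=> x; apply: cvgB; last exact: cvg_cst.
  by apply: cvgM; [exact: muct|exact: gct].
have [s1 s1t gM] := EVT_max t0 gct.
have [s2 s2t muM] := EVT_max t0 imuct.
have gs1 : 0 <= g s1 by apply: g0; exact: sub.
have mus2 : 0 < 1 / mu s2 by rewrite divr_gt0// mu0// in0t.
(* the sum of the two maxima bounds both g and 1 / mu on [0, t] *)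
have [L L0 lip] := alpha_lip t (g s1 + 1 / mu s2) (ltr_wpDl gs1 mus2).
have y0 : y 0 <= 0 by rewrite subr_le0.
rewrite -subr_le0 leNgt; apply/negP => yt.
have [c [/andP[c0 ct] yc0 ygt]] := last_level_point yc t0 y0 yt.
have ct_sub : `[c, t] `<=` `[0, t].
  by move=> s /=; rewrite !in_itv/= => /andP[/(le_trans c0)-> ->].
have : y t <= y c * expR (L * (t - c)).
  apply: right_derivative_gronwall (ltW ct) (continuous_subspaceW ct_sub yc) _.
  move=> s /andP[cs st].
  have s0 := le_trans c0 cs.
  have ys : 0 <= y s.
    have [->|sc] := eqVneq s c; first by rewrite yc0.
    by rewrite ltW// ygt// lt_neqAle eq_sym sc cs ltW.
  have st0 : s \in `[0, t] by rewrite in_itv/= s0 ltW.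
  have [ds dds ds_le] := dg s (sub s st0).
  have [l dl l_le] := supersolution_excess (mu0 _ s0)
    (C1_right_derivative muC s0) dds ds_le (mu_ineq _ s0).
  exists l => //; apply: (le_trans l_le).
  have mus := mu0 _ s0.
  have imus : 0 < 1 / mu s by rewrite divr_gt0.
  have gs : 0 <= g s by apply: g0; exact: sub.
  have img : 1 / mu s <= g s.
    by rewrite ler_pdivrMr// mulrC -subr_ge0.
  have gsM : `|g s| <= g s1 + 1 / mu s2.
    by rewrite ger0_norm// ler_wpDr ?gM// ltW.
  have musM : `|1 / mu s| <= g s1 + 1 / mu s2.
    by rewrite ger0_norm ?(ltW imus)// ler_wpDl// muM.
  have : mu s * (alpha s (g s) - alpha s (1 / mu s)) <= L * y s.
    have -> : L * y s = mu s * (L * `|g s - 1 / mu s|).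
      by rewrite ger0_norm ?subr_ge0// /y; field; rewrite gt_eqF.
    rewrite ler_pM2l// (le_trans (ler_norm _))// lip//.
    by rewrite ltW.
  have := supersolution_rate_ge0 (alpha0 _ _ s0 (ltW imus)) (beta0 _ s0) mus
    (mu_ineq _ s0).
  rewrite -/(y s) => rate0 lipy.
  by rewrite (le_trans _ lipy)// gerDr mulNr oppr_le0 mulr_ge0.
by rewrite yc0 mul0r leNgt yt.
Qed.

(** As [g <= 1 / mu], monotonicity of [alpha] leaves only the damping term, and
    a damping of bounded rate does not bring a negative [y] to [0] in finite
    time. *)
Lemma supersolution_strict_bound (R : realType) (gamma beta : R -> R)
    (alpha : R -> R -> R) (T : \bar R) (g mu dmu : R -> R) :
  {within @Rplus R, continuous gamma} ->
  (forall t g h, 0 <= t -> 0 <= h -> h <= g -> alpha t h <= alpha t g) ->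
  solution gamma alpha beta T g -> C1_Rplus mu dmu ->
  (forall t, 0 <= t -> 0 < mu t) ->
  (forall t, 0 <= t ->
     alpha t (1 / mu t) + beta t <= 1 / mu t * (gamma t - dmu t / mu t)) ->
  (forall t, upto T t -> mu t * g t <= 1) ->
  mu 0 * g 0 < 1 -> forall t, upto T t -> mu t * g t < 1.
Proof.
move=> gammac alpha_nd [_ g0 gc dg] muC mu0 mu_ineq bnd init t tT.
have t0 : 0 <= t by case: tT.
have sub := segment_upto tT.
have gct := continuous_subspaceW sub gc.
have muct := continuous_subspaceW (@segment_Rplus R t) (C1_continuous muC).
have ratec := continuous_subspaceW (@segment_Rplus R t)
  (C1_rate_continuous gammac muC mu0).
pose y s := mu s * g s - 1.
have yc : {within `[0, t], continuous y}.
  move=> x; apply: cvgB; last exact: cvg_cst.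
  by apply: cvgM; [exact: muct|exact: gct].
have [k _ rateK] := EVT_max t0 ratec.
set K := gamma k - dmu k / mu k in rateK.
have : y t <= y 0 * expR (- K * (t - 0)).
  apply: right_derivative_gronwall => // s /andP[s0 st].
  have st0 : s \in `[0, t] by rewrite in_itv/= s0 ltW.
  have sT := sub s st0.
  have [ds dds ds_le] := dg s sT.
  have [l dl l_le] := supersolution_excess (mu0 _ s0)
    (C1_right_derivative muC s0) dds ds_le (mu_ineq _ s0).
  exists l => //; apply: (le_trans l_le).
  have mus := mu0 _ s0.
  have ys : y s <= 0 by rewrite subr_le0 bnd.
  have gim : g s <= 1 / mu s by rewrite ler_pdivlMr// mulrC bnd.
  have : mu s * (alpha s (g s) - alpha s (1 / mu s)) <= 0.
    by rewrite pmulr_rle0// subr_le0 alpha_nd// g0.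
  have : 0 <= (K - (gamma s - dmu s / mu s)) * - y s.
    by rewrite mulr_ge0 ?oppr_ge0// subr_ge0 rateK.
  rewrite -/(y s); lra.
rewrite -subr_lt0 -/(y t) => /le_lt_trans; apply.
by rewrite pmulr_llt0 ?expR_gt0// subr_lt0.
Qed.

(** * Extension of solutions and global existence *)

(** The function [C * t - g t] is nondecreasing and bounded above by
    [C * b - m]. *)
Lemma right_derivative_le_left_limit (R : realType) (g : R -> R) (a b C m : R) :
  a < b -> 0 <= C -> {within `[a, b[, continuous g} ->
  (forall t, a <= t < b -> m <= g t) ->
  (forall t, a <= t < b -> exists2 l, right_derivative g t l & l <= C) ->
  exists2 l, m <= l & g t @[t --> b^'-] --> l.
Proof.
move=> ab C0 gc mg dg.
have C_rd t : right_derivative (fun s => C * s) t C.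
  apply: right_derivative_is_derive.
  by apply: is_derive_eq; rewrite /GRing.scale /= !mulr1.
have mono s t : a <= s -> s <= t -> t < b -> C * s - g s <= C * t - g t.
  move=> sa st tb; rewrite -[_ <= _]lerN2 !opprB.
  have sub : `[s, t] `<=` `[a, b[.
    move=> x /=; rewrite !in_itv/= => /andP[/(le_trans sa)-> xt].
    exact: le_lt_trans tb.
  apply: (@right_derivative_le0_nonincreasing _ (fun x => g x - C * x)) => //.
    move=> x; apply: cvgB; first exact: continuous_subspaceW sub gc x.
    apply: cvgM; first exact: cvg_cst.
    by apply: continuous_subspaceT => y; exact: cvg_id.
  move=> x /andP[sx xt]; have [|l dl lC] := dg x.
    by rewrite (le_trans sa)//= (lt_trans xt).
  by exists (l - C); [exact: right_derivativeB|rewrite subr_le0].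
have cv : cvg (C * t - g t @[t --> b^'-]).
  apply: nondecreasing_at_left_is_cvgr.
    apply: filterS (nbhs_left_ge ab) => x ax s t.
    rewrite !in_itv/= => /andP[xs _] /andP[_ tb] st.
    by apply: mono => //; exact: le_trans (ltW xs).
  apply: filterS (nbhs_left_ge ab) => x ax; exists (C * b - m) => _ [t + <-].
  rewrite /= in_itv/= => /andP[xt tb].
  by rewrite lerB// ?ler_wpM2l// ?(ltW tb)// mg// tb andbT (le_trans ax)// ltW.
have gl : g t @[t --> b^'-] --> C * b - lim (C * t - g t @[t --> b^'-]).
  have : C * t - (C * t - g t) @[t --> b^'-] -->
         C * b - lim (C * t - g t @[t --> b^'-]).
    apply: cvgB; last exact: cv.
    by apply: cvgM; [exact: cvg_cst|apply: cvg_at_left_filter; exact: cvg_id].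
  by apply: cvg_trans; apply: near_eq_cvg; near=> t; ring.
exists (C * b - lim (C * t - g t @[t --> b^'-])) => //.
apply: (cvgr_to_ge gl); near=> t; rewrite mg//; apply/andP; split.
  by near: t; exact: nbhs_left_ge.
by near: t; exact: nbhs_left_lt.
Unshelve. all: by end_near. Qed.

(** Since [alpha] and [beta] are nonnegative, a nonnegative function with
    [h' <= - gamma * h] is a solution of the differential inequality. An
    exponential decaying fast enough, attached at the left limit [l], is such a
    function. *)
Lemma solution_extension (R : realType) (gamma beta : R -> R)
    (alpha : R -> R -> R) (T l : R) (g : R -> R) :
  {within @Rplus R, continuous gamma} ->
  (forall t, 0 <= t -> 0 <= beta t) ->
  (forall t g, 0 <= t -> 0 <= g -> 0 <= alpha t g) ->
  solution gamma alpha beta T%:E g -> 0 <= l -> g t @[t --> T^'-] --> l ->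
  exists2 h, solution gamma alpha beta (T + 1)%:E h &
    forall t, upto T%:E t -> h t = g t.
Proof.
move=> gammac beta0 alpha0 [T0 g0 gc dg] l0 gl.
rewrite lte_fin in T0.
have TT1 : T <= T + 1 by rewrite lerDl.
have sub : `[T, T + 1] `<=` @Rplus R.
  by move=> t /=; rewrite in_itv/= => /andP[/(le_trans (ltW T0))].
have [k _ gammaK] := EVT_max TT1 (continuous_subspaceW sub gammac).
set K := gamma k in gammaK.
(* l exp(- K (t - T)), as a constant times exp(- K t) *)
pose tail t := l * expR (K * T) * expR (- K * t).
have tailT : tail T = l.
  by rewrite /tail -mulrA -expRD mulNr subrr expR0 mulr1.
have tail0 t : 0 <= tail t by rewrite !mulr_ge0// expR_ge0.
have tailc : continuous tail.
  move=> t; apply: cvgM; first exact: cvg_cst.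
  apply: continuous_comp; last exact: continuous_expR.
  by apply: cvgM; [exact: cvg_cst|exact: cvg_id].
have tail_rd t : right_derivative tail t (- K * tail t).
  apply: right_derivative_is_derive.
  by apply: is_derive_eq; rewrite /tail /GRing.scale /=; ring.
pose h t := if t < T then g t else tail t.
have hg t : t < T -> h t = g t by rewrite /h => ->.
have htail t : T <= t -> h t = tail t by rewrite /h leNgt; case: ifP.
have uptoT t : 0 <= t -> t < T -> upto T%:E t by split; rewrite ?lte_fin.
exists h; last by move=> t [_]; rewrite lte_fin => /hg.
split.
- by rewrite lte_fin ltr_pwDr// ltW.
- move=> t [t0 _]; have [tT|Tt] := ltP t T; last by rewrite htail.
  by rewrite hg// g0//; exact: uptoT.
- apply/subspace_continuousP => x [x0 _]; rewrite /from_subspace.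
  have [xT|Tx] := ltP x T.
    rewrite hg// => V Vg.
    have := (subspace_continuousP _ _).1 gc x (uptoT _ x0 xT) V Vg.
    apply: (@filterS2 _ (nbhs x)) (lt_nbhsl xT) => s sT gV [s0 _].
    by rewrite /= hg//; apply: gV; exact: uptoT.
  rewrite htail// => V Vtail.
  have near_g : \forall s \near x, s < T -> V (g s).
    have [xT|xT] := eqVneq x T.
      by rewrite xT tailT in Vtail *; exact: gl Vtail.
    have {xT} Tx1 : T < x by rewrite lt_neqAle eq_sym xT.
    by apply: filterS (lt_nbhsr Tx1) => s Ts; rewrite ltNge ltW.
  apply: (@filterS2 _ (nbhs x)) near_g (tailc x V Vtail) => s gV tV _.
  rewrite /=; have [sT|Ts] := ltP s T; first by rewrite hg//; exact: gV.
  by rewrite htail.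
- move=> t [t0]; rewrite lte_fin => tT1; have [tT|Tt] := ltP t T.
    have [d dd d_le] := dg t (uptoT _ t0 tT).
    exists d; last by rewrite hg.
    apply: near_eq_right_derivative dd; last by rewrite hg.
    have tT0 : 0 < T - t by rewrite subr_gt0.
    apply: filterS (nbhs_right_lt tT0) => s sT.
    by rewrite hg// -ltrBrDl.
  exists (- K * tail t).
    apply: near_eq_right_derivative (tail_rd t); last by rewrite htail.
    apply: filterS (nbhs_right_gt 0) => s s0.
    by rewrite htail// (le_trans Tt)// lerDl ltW.
  rewrite htail// -addrA ler_wpDr ?addr_ge0 ?alpha0 ?beta0//.
  by rewrite ler_wpM2r// lerN2 gammaK// in_itv/= Tt ltW.
Qed.

(** The hypothesis on [mu] bounds [g'] from above by the right-hand side of that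
    hypothesis, which is continuous, hence bounded on [0, T] for finite [T]. *)
Lemma bounded_maximal_solution_global (R : realType)
    (gamma beta mu dmu : R -> R) (alpha : R -> R -> R) (T : \bar R) (g : R -> R) :
  {within @Rplus R, continuous gamma} ->
  (forall t, 0 <= t -> 0 <= gamma t) ->
  (forall t, 0 <= t -> 0 <= beta t) ->
  (forall t g, 0 <= t -> 0 <= g -> 0 <= alpha t g) ->
  (forall t g h, 0 <= t -> 0 <= h -> h <= g -> alpha t h <= alpha t g) ->
  C1_Rplus mu dmu -> (forall t, 0 <= t -> 0 < mu t) ->
  (forall t, 0 <= t ->
     alpha t (1 / mu t) + beta t <= 1 / mu t * (gamma t - dmu t / mu t)) ->
  maximal_solution gamma alpha beta T g ->
  (forall t, upto T t -> mu t * g t <= 1) -> T = +oo%E.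
Proof.
move=> gammac gamma0 beta0 alpha0 alpha_nd muC mu0 mu_ineq [gsol gmax] bnd.
case: T gsol gmax bnd => [T|//|] gsol gmax bnd; last by case: gsol.
have [T0 g0 gc dg] := gsol; rewrite lte_fin in T0.
have supc : {within `[0, T],
    continuous (fun s => 1 / mu s * (gamma s - dmu s / mu s))}.
  apply: (continuous_subspaceW (@segment_Rplus R T)).
  move=> s; apply: cvgM; last exact: (C1_rate_continuous gammac muC mu0).
  by apply: cvgM; [exact: cvg_cst|exact: (C1_inv_continuous muC mu0)].
have [k k0T supM] := EVT_max (ltW T0) supc.
set C := 1 / mu k * _ in supM.
have k0 : 0 <= k by move: k0T; rewrite in_itv/= => /andP[].
have C0 : 0 <= C.
  apply: le_trans (mu_ineq k k0); rewrite addr_ge0 ?beta0 ?alpha0//.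
  by rewrite divr_ge0// ltW// mu0.
have [|||l l0 gl] := @right_derivative_le_left_limit _ g 0 T C 0 T0 C0.
- apply: continuous_subspaceW gc => t /=; rewrite in_itv/= => /andP[t0 tT].
  by split; rewrite ?lte_fin.
- by move=> t /andP[t0 tT]; apply: g0; split; rewrite ?lte_fin.
- move=> t /andP[t0 tT].
  have tuT : upto T%:E t by split; rewrite ?lte_fin.
  have [d dd d_le] := dg t tuT; exists d => //.
  have gt0 := g0 t tuT.
  apply: le_trans d_le _; apply: le_trans (supM t _); last first.
    by rewrite in_itv/= t0 ltW.
  apply: le_trans (mu_ineq t t0).
  rewrite lerD2r ler_wnDl ?mulNr ?oppr_le0 ?mulr_ge0 ?gamma0//.
  by rewrite alpha_nd// ler_pdivlMr ?mu0// mulrC bnd.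
have [h hsol hg] := solution_extension gammac beta0 alpha0 gsol l0 gl.
have TT1 : (T%:E <= (T + 1)%:E)%E by rewrite lee_fin lerDl.
have [] := gmax _ h TT1 hsol hg.
by move/eqP; rewrite -subr_eq0 addrAC subrr add0r oner_eq0.
Qed.

Theorem theorem1 (R : realType)
  (gamma beta : R -> R) (alpha : R -> R -> R)
  (gamma_cont : {within @Rplus R, continuous gamma})
  (gamma_ge0 : forall t, 0 <= t -> 0 <= gamma t)
  (beta_cont : {within @Rplus R, continuous beta})
  (beta_ge0 : forall t, 0 <= t -> 0 <= beta t)
  (alpha_cont : {within @Rplus R `*` @Rplus R,
                   continuous (fun p : R * R => alpha p.1 p.2)})
  (alpha_ge0 : forall t g, 0 <= t -> 0 <= g -> 0 <= alpha t g)
  (alpha_nondecr : forall t g h, 0 <= t -> 0 <= h -> h <= g ->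
                     alpha t h <= alpha t g)
  (alpha_lip : locally_lipschitz2 alpha)
  (T : \bar R) (g : R -> R)
  (g_sol : solution gamma alpha beta T g)
  (mu dmu : R -> R)
  (mu_C1 : C1_Rplus mu dmu)
  (mu_gt0 : forall t, 0 <= t -> 0 < mu t)
  (mu_ineq : forall t, 0 <= t ->
     alpha t (1 / mu t) + beta t <= 1 / mu t * (gamma t - dmu t / mu t)) :
  (mu 0 * g 0 < 1 ->
     (forall t, upto T t -> 0 <= g t < 1 / mu t) /\
     (maximal_solution gamma alpha beta T g ->
        T = +oo%E /\ forall t, 0 <= t -> 0 <= g t < 1 / mu t)) /\
  (mu 0 * g 0 <= 1 ->
     (forall t, upto T t -> 0 <= g t <= 1 / mu t) /\
     (maximal_solution gamma alpha beta T g ->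
        T = +oo%E /\ forall t, 0 <= t -> 0 <= g t <= 1 / mu t)).

Proof.
have bound_mu t : 0 <= t -> mu t * g t <= 1 -> g t <= 1 / mu t.
  by move=> t0; rewrite ler_pdivlMr ?mu_gt0// mulrC.
have strict_mu t : 0 <= t -> mu t * g t < 1 -> g t < 1 / mu t.
  by move=> t0; rewrite ltr_pdivlMr ?mu_gt0// mulrC.
have bound := supersolution_bound beta_ge0 alpha_ge0 alpha_lip g_sol mu_C1
  mu_gt0 mu_ineq.
have global init gmax : T = +oo%E :=
  bounded_maximal_solution_global gamma_cont gamma_ge0 beta_ge0 alpha_ge0
    alpha_nondecr mu_C1 mu_gt0 mu_ineq gmax (bound init).
have g_ge0 t : upto T t -> 0 <= g t by case: g_sol => _ + _ _; exact.
have upto_oo t : T = +oo%E -> 0 <= t -> upto T t.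
  by move=> -> t0; split; rewrite ?ltry.
split=> init.
- have init_le := ltW init.
  have strict t : upto T t -> 0 <= g t < 1 / mu t.
    move=> tT; rewrite g_ge0// strict_mu//; first by case: tT.
    exact: (supersolution_strict_bound gamma_cont alpha_nondecr g_sol mu_C1
      mu_gt0 mu_ineq (bound init_le)).
  split=> // gmax; have Too := global init_le gmax.
  by split=> // t t0; apply: strict; exact: upto_oo.
- have large t : upto T t -> 0 <= g t <= 1 / mu t.
    move=> tT; rewrite g_ge0//= bound_mu//; first by case: tT.
    exact: bound.
  split=> // gmax; have Too := global init gmax.
  by split=> // t t0; apply: large; exact: upto_oo.
Qed.
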